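(* For $a\in\mathbb{Z}$ define the post-critically finite polynomials $$f_a(x)=(x+a)^2-a,\qquad g_a(x)=(x+a)^2-a-1,\qquad h_a(x)=(x+a)^2-a-2,$$ whose discriminants $D$ satisfy $D/4=a$, $D/4=a+1$, $D/4=a+2$, respectively. Then: 1. Every iterate $f_a^n$ ($n\ge1$) is monogenic if and only if $a$ is squarefree and $a\equiv 2$ or $3\pmod 4$. 2. Every iterate $g_a^n$ ($n\ge 1$) is monogenic if and only if $a$ and $a+1$ are both squarefree and $a+1\equiv 2$ or $3\pmod 4$. 3. Every iterate $h_a^n$ ($n\ge1$) is monogenic if and only if $a-2$ and $a+2$ are both squarefree and $a+2\equiv 2$ or $3\pmod 4$.
   Context: For a polynomial $f$, $f^n=f\circ\cdots\circ f$ ($n$ times). A monic polynomial $g\in\mathbb{Z}[x]$ is monogenic if it is irreducible and, for a root $\alpha$ of $g$, $\mathcal{O}_{\mathbb{Q}(\alpha)}=\mathbb{Z}[\alpha]$, where $\mathcal{O}_{\mathbb{Q}(\alpha)}$ is the ring of integers of $\mathbb{Q}(\alpha)$. A polynomial is post-critically finite (PCF) if the forward orbit of its critical points under iteration is a finite set. An integer is squarefree if it is not divisible by the square of any prime (so $0$ is not squarefree). *)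

(* Defs.v *)
From mathcomp Require Import all_boot all_order all_algebra all_field.

Set Implicit Arguments.
Unset Strict Implicit.
Unset Printing Implicit Defensive.

Import Order.TTheory GRing.Theory Num.Theory.
Local Open Scope ring_scope.

(* 0 is not squarefree, since every square divides it. *)
Definition squarefree (a : int) : Prop :=
  forall p : nat, prime p -> ~~ ((p ^ 2)%N%:Z %| a)%Z.

Definition iter_poly (n : nat) (p : {poly int}) : {poly int} :=
  iter n (fun q => p \Po q) 'X.

Definition in_Q_adjoin (alpha x : algC) : Prop :=
  exists u v : {poly rat},
    (map_poly ratr v).[alpha] != 0 /\
    x = (map_poly ratr u).[alpha] / (map_poly ratr v).[alpha].

Definition in_Z_adjoin (alpha x : algC) : Prop :=
  exists u : {poly int}, x = (map_poly intr u).[alpha].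

(* Irreducibility is over Q: on {poly int} the library's divisibility is
   pseudo-division, and for monic polynomials the two notions agree (Gauss). *)
Definition monogenic (g : {poly int}) : Prop :=
  [/\ g \is monic,
      irreducible_poly (map_poly intr g : {poly rat}) &
      forall alpha : algC, root (map_poly intr g) alpha ->
      forall x : algC,
        (in_Q_adjoin alpha x /\ x \in Aint) <-> in_Z_adjoin alpha x].

(* All critical points of an integer polynomial with nonzero derivative are
   algebraic, so algC contains their whole complex orbits. *)
Definition pcf (g : {poly int}) : Prop :=
  let gC : {poly algC} := map_poly intr g in
  exists s : seq algC,
    forall (c : algC) (n : nat), root gC^`() c -> iter n (horner gC) c \in s.

Definition croots (p : {poly algC}) : seq algC :=
  sval (closed_field_poly_normal p).

(* lc^(2d-2) * \prod_(i < j) (r_i - r_j)^2, the r_i being the d complex roots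
   listed with multiplicity. *)
Definition discriminant (g : {poly int}) : algC :=
  let rs := croots (map_poly intr g) in
  (lead_coef g)%:~R ^+ (2 * size rs - 2) *
  \prod_(i < size rs) \prod_(j < size rs | (i < j)%N) (rs`_i - rs`_j) ^+ 2.

Definition f_ (a : int) : {poly int} := ('X + a%:P) ^+ 2 - a%:P.
Definition g_ (a : int) : {poly int} := ('X + a%:P) ^+ 2 - a%:P - 1.
Definition h_ (a : int) : {poly int} := ('X + a%:P) ^+ 2 - a%:P - 2%:P.

(* Main.v *)
Require Import Defs.
From mathcomp Require Import all_boot all_order all_algebra all_field.
From mathcomp Require Import ring zify.

Import Order.TTheory GRing.Theory Num.Theory.
Local Open Scope ring_scope.

(** The three families are the quadratics q = (X + b)^2 + e with b = a and
    e = -a, -a-1, -a-2.  Their only critical point is -b, and its orbit is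
    {-a}, {-a, -a-1}, and -a, -a-2, 2-a, 2-a, ... respectively; this gives the
    PCF claims and turns the conditions of the theorem into conditions on the
    integers q^n(-b).

    Sufficiency ([quad_monogenic]).  Write F_n for the n-th iterate.  A root x
    of F_(n+1) lies over the root z = q(x) of F_n, and with y = x + b one has
    y^2 = z - e.  By induction Z[z] is the full ring of integers of Q(z).  For
    an algebraic integer u + v y of Q(x), with u and v in Q(z), the conjugation
    y -> -y shows that 2u and 2vy are integral.  Now Z[z] / (z - e) is
    Z / F_n(e), and F_n(e) = F_(n+1)(-b) is squarefree, so this quotient is
    reduced; that is exactly what is needed to deduce from the integrality of
    2vy that 2v lies in Z[z].  Hence only the prime 2 can divide the index of
    Z[x] ([step_half]).  Modulo 2 every iterate is (X - s)^(2^n) + F_n(s), so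
    as soon as some value F_n(s) is 2 modulo 4, the polynomial F_n is
    Eisenstein at 2 around s: this gives both its irreducibility
    ([eis_irreducible]) and maximality of Z[x] at 2 ([eis_half]).  By
    the congruence conditions modulo 4 in the theorem, some point of a cycle of
    q is 2 modulo 4; since q permutes the cycle, every F_n takes this value.

    Necessity uses the first two iterates only.  If F is monogenic, then no
    monic P with deg P < deg F has P(x) / p integral
    ([monogenic_not_divisible]).  When p^2 divides q(-b) = e this is
    contradicted by P = y, when p^2 divides q(q(-b)) by
    P = y (y^2 + 2(e + b)), whose square is -q(q(-b)) (y^2 + 2(e + b)), and
    when e = 3 modulo 4 by P = y + 1 with p = 2. *)

(** * Evaluating integer and rational polynomials at algebraic numbers *)

Notation evZ P x := (@horner algC (map_poly intr P) x).
Notation evQ P x := (@horner algC (map_poly ratr P) x).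
Notation toQ P := (@map_poly int rat intr P).

Lemma evQ_toQ (P : {poly int}) (x : algC) : evQ (toQ P) x = evZ P x.
Proof.
rewrite -map_poly_comp; congr (_.[x]).
by apply: eq_map_poly => z /=; rewrite ratr_int.
Qed.

Lemma evZD (P Q : {poly int}) (x : algC) : evZ (P + Q) x = evZ P x + evZ Q x.
Proof. by rewrite rmorphD hornerD. Qed.
Lemma evZN (P : {poly int}) (x : algC) : evZ (- P) x = - evZ P x.
Proof. by rewrite rmorphN hornerN. Qed.
Lemma evZM (P Q : {poly int}) (x : algC) : evZ (P * Q) x = evZ P x * evZ Q x.
Proof. by rewrite rmorphM hornerM. Qed.
Lemma evZMn (P : {poly int}) n (x : algC) : evZ (P *+ n) x = evZ P x *+ n.
Proof. by rewrite rmorphMn hornerMn. Qed.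
Lemma evZXn (P : {poly int}) n (x : algC) : evZ (P ^+ n) x = evZ P x ^+ n.
Proof. by rewrite rmorphXn horner_exp. Qed.
Lemma evZC (c : int) (x : algC) : evZ c%:P x = c%:~R.
Proof. by rewrite map_polyC hornerC. Qed.
Lemma evZX (x : algC) : evZ 'X x = x.
Proof. by rewrite map_polyX hornerX. Qed.
Lemma evZ1 (x : algC) : evZ 1 x = 1.
Proof. by rewrite rmorph1 hornerC. Qed.
Lemma evZ_comp (P Q : {poly int}) (x : algC) :
  evZ (P \Po Q) x = evZ P (evZ Q x).
Proof. by rewrite map_comp_poly horner_comp. Qed.
Lemma evZ_int (P : {poly int}) (c : int) : evZ P c%:~R = (P.[c])%:~R.
Proof. by rewrite horner_map. Qed.

Lemma evQD (P Q : {poly rat}) (x : algC) : evQ (P + Q) x = evQ P x + evQ Q x.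
Proof. by rewrite rmorphD hornerD. Qed.
Lemma evQN (P : {poly rat}) (x : algC) : evQ (- P) x = - evQ P x.
Proof. by rewrite rmorphN hornerN. Qed.
Lemma evQM (P Q : {poly rat}) (x : algC) : evQ (P * Q) x = evQ P x * evQ Q x.
Proof. by rewrite rmorphM hornerM. Qed.
Lemma evQXn (P : {poly rat}) n (x : algC) : evQ (P ^+ n) x = evQ P x ^+ n.
Proof. by rewrite rmorphXn horner_exp. Qed.
Lemma evQC (c : rat) (x : algC) : evQ c%:P x = ratr c.
Proof. by rewrite map_polyC hornerC. Qed.
Lemma evQX (x : algC) : evQ 'X x = x.
Proof. by rewrite map_polyX hornerX. Qed.
Lemma evQ1 (x : algC) : evQ 1 x = 1.
Proof. by rewrite rmorph1 hornerC. Qed.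
Lemma evQ_comp (P Q : {poly rat}) (x : algC) :
  evQ (P \Po Q) x = evQ P (evQ Q x).
Proof. by rewrite map_comp_poly horner_comp. Qed.

Definition evE :=
  (evZD, evZN, evZM, evZMn, evZXn, evZ1, evZC, evZX, evZ_comp,
   evQD, evQN, evQM, evQXn, evQ1, evQC, evQX, evQ_comp, evQ_toQ).

Lemma poly_sub_horner (P : {poly int}) (s : int) :
  exists Q, P = P.[s]%:P + ('X - s%:P) * Q.
Proof.
have /factor_theorem[Q dQ] : root (P - P.[s]%:P) s.
  by rewrite /root !hornerE subrr.
by exists Q; rewrite mulrC -dQ addrC subrK.
Qed.

(** * Algebraic integers and squarefree integers *)

Lemma Aint_root_monic (P : {poly int}) (x : algC) :
  P \is monic -> evZ P x = 0 -> x \in Aint.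
Proof.
move=> mP Px0; apply: (@root_monic_Aint (map_poly intr P)); last 1 first.
- by apply/polyOverP=> i; rewrite coef_map /= intr_int.
- by rewrite /root Px0.
- exact: monic_map.
Qed.

Lemma Aint_monicP (x : algC) :
  x \in Aint -> exists2 P : {poly int}, P \is monic & evZ P x = 0.
Proof.
rewrite unfold_in => /floorpP[P dP].
exists P; last by apply/eqP; rewrite -dP; exact: root_minCpoly.
have := minCpoly_monic x.
rewrite !monicE dP lead_coef_map_inj //; last exact: intr_inj.
by rewrite -(rmorph1 (intr : int -> algC)) (inj_eq intr_inj).
Qed.

Lemma Aint_of_exp (x : algC) n : (0 < n)%N -> x ^+ n \in Aint -> x \in Aint.
Proof.
move=> n_gt0 /Aint_monicP[P mP Px]; apply: (@Aint_root_monic (P \Po 'X^n)).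
  rewrite monicE lead_coef_comp ?size_polyXn //.
  by rewrite (monicP mP) lead_coefXn expr1n mulr1.
by rewrite evZ_comp evZXn evZX.
Qed.

Lemma Aint_evZ (P : {poly int}) (x : algC) : x \in Aint -> evZ P x \in Aint.
Proof.
move=> Ax; apply: rpred_horner => //.
by apply/polyOverP=> i; rewrite coef_map Aint_int.
Qed.

Lemma Aint_ratio (p m : int) :
  p != 0 -> (m%:~R / p%:~R : algC) \in Aint -> (p %| m)%Z.
Proof.
move=> p0 A; have /intrP[k dk] : (m%:~R / p%:~R : algC) \in Num.int.
  by apply: Cint_rat_Aint => //; rewrite rpred_div ?rpred_int.
apply/dvdzP; exists k; apply: (@intr_inj algC).
by rewrite intrM -dk divfK // intr_eq0.
Qed.

Lemma squarefree_neq0 N : squarefree N -> N != 0.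
Proof. by move=> /(_ 2 isT); apply: contraNneq => ->; rewrite dvdz0. Qed.

Lemma squarefreeN N : squarefree (- N) <-> squarefree N.
Proof. by split=> H p /H; rewrite !dvdzE abszN. Qed.

Lemma squarefree_mod4 N : squarefree N -> (N <> 0 %[mod 4])%Z.
Proof.
by move=> /(_ 2 isT) H E; move: H; rewrite -[((2 ^ 2)%N : int)]/(4 : int); lia.
Qed.

Lemma squarefree_dvd_sqr (N r : int) :
  squarefree N -> (N %| r ^+ 2)%Z -> (N %| r)%Z.
Proof.
move=> sqN; have N0 := squarefree_neq0 _ sqN; rewrite !dvdzE abszX => Nr.
have n0 : (0 < `|N|)%N by rewrite absz_gt0.
apply/dvdn_partP => // p; rewrite mem_primes => /and3P[pp _ pN].
rewrite p_part; suff -> : logn p `|N| = 1%N.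
  by have := dvdn_trans pN Nr; rewrite Euclid_dvdX // andbT.
apply/eqP; rewrite eqn_leq andbC -pfactor_dvdn // expn1 pN /=.
by have := sqN p pp; rewrite dvdzE /= leqNgt pfactor_dvdn.
Qed.

(** * Roots of an irreducible monic polynomial *)

Section Minimality.
Variables (F : {poly int}) (x : algC).
Hypotheses (mF : F \is monic) (iF : irreducible_poly (toQ F)).
Hypothesis Fx : evZ F x = 0.

Lemma irr_dvd_rat (u : {poly rat}) : evQ u x = 0 -> toQ F %| u.
Proof.
move=> ux; apply: contraT; rewrite -irreducible_poly_coprime //.
rewrite -(coprimep_map (ratr : rat -> algC)) => /coprimep_root co.
by have := co x; rewrite ux eqxx /root evQ_toQ Fx eqxx => /(_ isT).
Qed.

(** Divisibility by F holds over Z and not only over Q because F is monic. *)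
Lemma irr_dvd_int (U : {poly int}) : evZ U x = 0 -> exists Q, U = Q * F.
Proof.
rewrite -evQ_toQ => /irr_dvd_rat; rewrite dvdp_rat_int => /modp_eq0P FU.
by exists (U %/ F); rewrite {1}(Pdiv.IdomainMonic.divp_eq mF U) FU addr0.
Qed.

Lemma irr_small (u : {poly rat}) :
  (size u < size F)%N -> evQ u x = 0 -> u = 0.
Proof.
move=> su /irr_dvd_rat/dvdp_leq du; apply: contraTeq su => /du.
by rewrite -leqNgt size_map_inj_poly //; exact: intr_inj.
Qed.

Lemma reduceZ (U : {poly int}) :
  exists2 V : {poly int}, (size V < size F)%N & evZ U x = evZ V x.
Proof.
exists (U %% F); first by rewrite ltn_modp monic_neq0.
by rewrite {1}(Pdiv.IdomainMonic.divp_eq mF U) evZD evZM Fx mulr0 add0r.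
Qed.

Lemma in_Q_adjoinP y :
  in_Q_adjoin x y <-> exists u : {poly rat}, y = evQ u x.
Proof.
split=> [[u [v [vx ->]]]|[u ->]]; last first.
  by exists u, 1; rewrite rmorph1 hornerC oner_eq0 divr1.
have: coprimep (toQ F) v.
  rewrite irreducible_poly_coprime //; apply: contra vx => /dvdpP[w ->].
  by rewrite !evE Fx mulr0.
case/Bezout_eq1_coprimepP=> -[a b] /= ab.
exists (u * b); rewrite evQM; congr (_ * _).
apply: (mulIf vx); rewrite mulVf //.
have /(congr1 (fun p : {poly rat} => evQ p x)) := ab.
by rewrite !evE Fx mulr0 add0r => <-.
Qed.

(** A monic integer polynomial killing u(x) becomes, after composition with u,
    a multiple of F, hence kills u(x') as well. *)
Lemma Aint_conj (u : {poly rat}) x' :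
  evZ F x' = 0 -> evQ u x \in Aint -> evQ u x' \in Aint.
Proof.
move=> Fx' /Aint_monicP[P mP Pu].
have /irr_dvd_rat/dvdpP[w dw] : evQ (toQ P \Po u) x = 0 by rewrite !evE.
apply: (Aint_root_monic P) => //.
by rewrite -evQ_toQ -evQ_comp dw !evE Fx' mulr0.
Qed.

End Minimality.

(** Elements of Q(x) are written as polynomials in x, which avoids the
    fractions of [in_Q_adjoin]; for algebraic x this is the same field. *)
Definition int_closed (x : algC) :=
  forall u : {poly rat}, evQ u x \in Aint ->
  exists U : {poly int}, evQ u x = evZ U x.

Lemma monogenicP (F : {poly int}) :
  F \is monic -> irreducible_poly (toQ F) ->
  (monogenic F <-> forall x, evZ F x = 0 -> int_closed x).
Proof.
move=> mF iF; split=> [[_ _ H] x Fx u Au|H].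
  have rx : root (map_poly intr F) x by apply/eqP.
  by apply/(H x rx); split=> //; apply/(in_Q_adjoinP F) => //; exists u.
split=> // x /eqP Fx y; split.
  by case=> /(in_Q_adjoinP F x iF Fx)[u ->]; apply: H.
case=> U ->; split.
  by apply/(in_Q_adjoinP F) => //; exists (toQ U); rewrite evQ_toQ.
by apply/Aint_evZ/(Aint_root_monic F).
Qed.

(** The powers of x below deg F are independent over Q, so P(x) = k V(x) with
    deg V < deg F forces P = k V, and k would divide the leading
    coefficient 1. *)
Lemma monogenic_not_divisible (F P : {poly int}) (k : nat) x :
  monogenic F -> P \is monic -> (size P < size F)%N -> evZ F x = 0 ->
  (1 < k)%N -> evZ P x / k%:R \notin Aint.
Proof.
move=> [mF iF H] mP sP Fx k1; apply/negP=> A.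
have k0 : (k%:R : algC) != 0 by rewrite pnatr_eq0 -lt0n ltnW.
have [||U dU] := (H x _ _).1 (conj _ A); first by apply/eqP.
  exists (toQ P), k%:R%:P.
  by rewrite !map_polyC !hornerC evQ_toQ /= rmorph_nat.
have [V sV dV] := reduceZ F x mF Fx U.
set D := P - k%:R%:P * V.
have Dx : evQ (toQ D) x = 0.
  rewrite evQ_toQ /D evZD evZN evZM -dV -dU evZC rmorph_nat mulrCA mulfV //.
  by rewrite mulr1 subrr.
have sD : (size D < size F)%N.
  rewrite (leq_ltn_trans (size_polyD _ _)) // size_polyN gtn_max sP /=.
  by rewrite mul_polyC (leq_ltn_trans (size_scale_leq _ _)).
have D0 : toQ D = 0.
  apply: (irr_small F x iF Fx) => //.
  by rewrite size_map_inj_poly //; exact: intr_inj.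
have /eqP : D = 0.
  apply: (map_inj_poly (intr_inj : injective (intr : int -> rat))) => //.
  by rewrite rmorph0.
rewrite subr_eq0 => /eqP dP.
have /monicP := mP; rewrite dP mul_polyC lead_coefZ => /(congr1 absz).
rewrite abszM natz absz_nat => /eqP; rewrite muln_eq1 => /andP[/eqP k1e _].
by rewrite k1e in k1.
Qed.

(** * Polynomials that are Eisenstein at 2 around an integer *)

Section Eisenstein.
Variables (F H : {poly int}) (s : int) (d : nat).
Hypotheses (mF : F \is monic) (dF : F = ('X - s%:P) ^+ d + H *+ 2).
Hypotheses (Hs : ~~ (2 %| H.[s])%Z) (d_gt0 : (0 < d)%N).

Section Root.
Variable x : algC.
Hypothesis Fx : evZ F x = 0.
Let y := x - s%:~R.

Lemma eis_pow : y ^+ d = - evZ H x * 2.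
Proof.
move: Fx; rewrite dF !evE => /eqP; rewrite addr_eq0 => /eqP.
by rewrite -mulr_natr mulNr.
Qed.

Lemma eis_Aint : x \in Aint.
Proof. exact: (Aint_root_monic F). Qed.

(** Since 2 divides y^d, an integer divisible by y has an even d-th power. *)
Lemma eis_not_dvd_odd (c : int) (t : algC) :
  ~~ (2 %| c)%Z -> t \in Aint -> c%:~R <> y * t.
Proof.
move=> c2 At /(congr1 (fun z => z ^+ d)); rewrite exprMn eis_pow => E.
have /Aint_ratio : ((c ^+ d)%:~R / 2%:~R : algC) \in Aint.
  rewrite rmorphXn /= E mulrAC mulfK ?pnatr_eq0 //.
  by rewrite rpredM ?rpredN ?rpredX ?Aint_evZ ?eis_Aint.
move=> /(_ isT); apply/negP.
by move: c2; rewrite !dvdzE abszX /= Euclid_dvdX // d_gt0 andbT.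
Qed.

(** Modulo 2 the coefficients of U along powers of X - s vanish one after the
    other.  If the first odd one is w, in degree i < d, then multiplying
    U(x) / 2 by y^(d-1-i) shows w y^(d-1) / 2 to be integral; times y this is
    -w H(x), so that y divides the odd integer w H(s). *)
Lemma eis_adic (U : {poly int}) :
  evZ U x / 2 \in Aint -> forall i, (i <= d)%N ->
  exists V W, U = V *+ 2 + ('X - s%:P) ^+ i * W.
Proof.
move=> AU; elim=> [_|i IHi ltid].
  by exists 0, U; rewrite mul0rn expr0 mul1r add0r.
have [V [W dU]] := IHi (ltnW ltid); have [W' dW] := poly_sub_horner W s.
case: (boolP (2 %| W.[s])%Z) => [/dvdzP[k dk]|w2].
  exists (V + ('X - s%:P) ^+ i * k%:P), W'; rewrite dU {1}dW dk rmorphM /=.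
  rewrite exprSr; ring.
have [H' dH] := poly_sub_horner H s.
have Ay : y \in Aint by rewrite rpredB ?eis_Aint ?Aint_int.
pose t := - (y ^+ (d.-1 - i) * (evZ U x / 2 - evZ V x)
             + evZ H x * evZ W' x + W.[s]%:~R * evZ H' x).
case: (@eis_not_dvd_odd (W.[s] * H.[s]) t).
- by rewrite !dvdzE abszM Euclid_dvdM // negb_or -!dvdzE w2 Hs.
- have Ax := eis_Aint.
  by rewrite rpredN !rpredD ?rpredM ?rpredX ?rpredB ?Aint_evZ ?Aint_int.
have yd : y ^+ d = y * (y ^+ (d.-1 - i) * y ^+ i).
  by rewrite -exprD -exprS; congr (_ ^+ _); lia.
have Ux : evZ U x / 2 - evZ V x = y ^+ i * evZ W x / 2.
  rewrite dU evZD evZMn !evE -/y -mulr_natr mulrDl mulfK ?pnatr_eq0 //.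
  by rewrite addrAC subrr add0r.
have Wx : evZ W x = W.[s]%:~R + y * evZ W' x by rewrite {1}dW !evE.
have Hx : evZ H x = H.[s]%:~R + y * evZ H' x by rewrite {1}dH !evE.
rewrite /t Ux rmorphM /=.
have -> : y * - (y ^+ (d.-1 - i) * (y ^+ i * evZ W x / 2)
                 + evZ H x * evZ W' x + W.[s]%:~R * evZ H' x)
   = - (y ^+ d * evZ W x / 2 + y * evZ H x * evZ W' x
        + W.[s]%:~R * (y * evZ H' x)).
  rewrite yd; ring.
rewrite eis_pow Wx; move: Hx; set a := evZ H x; set b := evZ H' x => Hx.
have -> : y * b = a - H.[s]%:~R by rewrite Hx; ring.
by field.
Qed.

(** Maximality of Z[x] at 2: once U is a multiple of (X - s)^d modulo 2, its
    value is even, because y^d is. *)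
Lemma eis_half (U : {poly int}) :
  evZ U x / 2 \in Aint -> exists V, evZ U x / 2 = evZ V x.
Proof.
move=> /eis_adic/(_ d (leqnn d))[V [W ->]]; exists (V - H * W).
rewrite !evE -/y eis_pow.
by rewrite -mulr_natr; field.
Qed.

End Root.

Hypothesis sF : size F = d.+1.

Lemma eis_irreducible : irreducible_poly (toQ F).
Proof.
apply/irreducible_rat_int.
have sXs : size ('X + s%:P) = 2%N by rewrite size_XaddC.
pose G := F \Po ('X + s%:P).
have dG : G = 'X^d + (H \Po ('X + s%:P)) *+ 2.
  rewrite /G dF rmorphD rmorphXn rmorphMn /= rmorphB /=.
  by rewrite comp_polyX comp_polyC addrK.
have sG : size G = d.+1 by rewrite size_comp_poly2.
have [_ irrG] : irreducible_poly G.
  apply: (@eisenstein_crit 2) => //.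
  - by rewrite sG; case: (d) d_gt0.
  - by rewrite lead_coef_comp ?sXs // (monicP mF) mul1r lead_coefXaddC expr1n.
  - have -> : G`_0 = 2 * H.[s].
      rewrite dG -horner_coef0 hornerD hornerXn hornerMn horner_comp !hornerE.
      by rewrite expr0n eqn0Ngt d_gt0 /= !add0r; ring.
    by rewrite expr2 PoszM dvdz_mul2l.
  - move=> i; rewrite sG /= => ltid.
    by rewrite dG coefD coefMn coefXn ltn_eqF // add0r -mulr_natl dvdz_mulr.
(* Translation by s preserves degrees and divisibility, so a factor of F gives
   a factor of G of the same degree. *)
split=> [|q sq qF]; first by rewrite sF.
have /irrG : size (q \Po ('X + s%:P)) != 1%N by rewrite size_comp_poly2.
move/(_ (dvdp_comp_poly _ qF)) => /eqp_size.
by rewrite !size_comp_poly2 // => sqF; rewrite -dvdp_size_eqp // sqF.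
Qed.

End Eisenstein.

(** * One quadratic step of the tower *)

Section Quadratic.
Variables (b e : int).
Definition quad : {poly int} := ('X + b%:P) ^+ 2 + e%:P.

Lemma horner_quad c : quad.[c] = (c + b) ^+ 2 + e.
Proof. by rewrite /quad !hornerE. Qed.

Lemma evZ_quad x : evZ quad x = (x + b%:~R) ^+ 2 + e%:~R.
Proof. by rewrite !evE. Qed.

Lemma quad_split (P : {poly rat}) : exists A B : {poly rat}, forall x,
  evQ P x = evQ A (evZ quad x) + (x + b%:~R) * evQ B (evZ quad x).
Proof.
elim/poly_ind: P => [|P c [A [B IH]]].
  by exists 0, 0 => x; rewrite !rmorph0 !horner0 mulr0 addr0.
(* x = y - b and y^2 = z - e, where y = x + b and z = quad(x). *)
exists (('X - e%:~R%:P) * B - b%:~R%:P * A + c%:P), (A - b%:~R%:P * B) => x.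
move: (IH x) (evZ_quad x); move: (evZ quad x) => q IHx dq.
by rewrite !evE IHx !ratr_int dq; ring.
Qed.

Section Step.
Variables (F : {poly int}) (x : algC).
Hypotheses (mF : F \is monic) (iF : irreducible_poly (toQ F)).
Hypothesis (iFq : irreducible_poly (toQ (F \Po quad))).
Let z := evZ quad x.
Hypotheses (Fz : evZ F z = 0) (icz : int_closed z) (sqN : squarefree F.[e]).
Let y := x + b%:~R.

Lemma step_sqr : y ^+ 2 = z - e%:~R.
Proof. rewrite /z evZ_quad -/y; ring. Qed.

Lemma step_neq0 : z - e%:~R != 0.
Proof.
apply: contra (squarefree_neq0 _ sqN); rewrite subr_eq0 => /eqP ze.
by have := Fz; rewrite ze evZ_int => /eqP; rewrite intr_eq0.
Qed.

(** Z[z] / (z - e) is Z / F(e), which is reduced as F(e) is squarefree. *)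
Lemma step_reduced (r s : {poly int}) :
  evZ r z ^+ 2 = (z - e%:~R) * evZ s z ->
  exists t, evZ r z = (z - e%:~R) * evZ t z.
Proof.
have [r' dr] := poly_sub_horner r e; have [F' dF] := poly_sub_horner F e.
move=> E; have : evZ (r ^+ 2 - ('X - e%:P) * s) z = 0.
  by rewrite !evE E subrr.
case/(irr_dvd_int F z mF iF Fz) => Q /(congr1 (horner^~ e)).
rewrite !hornerE subrr mul0r subr0 => rQ.
have /squarefree_dvd_sqr : (F.[e] %| r.[e] ^+ 2)%Z by rewrite rQ dvdz_mull.
case/(_ sqN)/dvdzP => k dk.
exists (r' - k%:P * F').
(* F(e) itself is a multiple of z - e, since F(z) = 0. *)
have Fe : (F.[e])%:~R = - ((z - e%:~R) * evZ F' z).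
  by have := Fz; rewrite {1}dF !evE => /eqP; rewrite addr_eq0 => /eqP.
by rewrite {1}dr !evE dk intrM Fe; ring.
Qed.

(** With P(x) = A(z) + y B(z), the conjugate A(z) - y B(z) is the value of P at
    the other root -2b - x of F over z. *)
Lemma step_half (P : {poly rat}) :
  evQ P x \in Aint -> exists U : {poly int}, evQ P x = evZ U x / 2.
Proof.
move=> AP; have [A [B dP]] := quad_split P.
have Fqx : evZ (F \Po quad) x = 0 by rewrite evZ_comp.
pose x' := - (x + b%:~R *+ 2).
have quad_x' : evZ quad x' = z by rewrite /z !evZ_quad /x'; ring.
have AP' : evQ P x' \in Aint.
  apply: (Aint_conj (F \Po quad) x iFq) AP => //.
  by rewrite evZ_comp quad_x'.
have dP' : evQ P x' = evQ A z - y * evQ B z.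
  by rewrite dP quad_x' /y /x'; ring.
have {dP} dP : evQ P x = evQ A z + y * evQ B z by rewrite dP.
have [U dU] : exists U : {poly int}, evQ (2%:P * A) z = evZ U z.
  apply: icz; rewrite !evE ratr_nat.
  have -> : 2 * evQ A z = evQ P x + evQ P x' by rewrite dP dP'; ring.
  by rewrite rpredD.
have Az : z \in Aint by apply: (Aint_root_monic F).
pose w := evQ (2%:P * B) z.
have Ayw : y * w \in Aint.
  rewrite /w !evE ratr_nat.
  have -> : y * (2 * evQ B z) = evQ P x - evQ P x' by rewrite dP dP'; ring.
  by rewrite rpredB.
have Ae : z - e%:~R \in Aint by rewrite rpredB ?Aint_int.
(* Both (y w)^2 = (z - e) w^2 and then (z - e) w are integral elements of
   Q(z), hence lie in Z[z]; as the square of the latter is divisible by z - e,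
   so is (z - e) w itself, that is, w lies in Z[z]. *)
have dyw : (y * w) ^+ 2 = evQ (('X - e%:~R%:P) * (2%:P * B) ^+ 2) z.
  by rewrite exprMn step_sqr expr2 !evE ratr_int /w !evE; ring.
have [s ds] : exists s : {poly int}, (y * w) ^+ 2 = evZ s z.
  by rewrite dyw; apply: icz; rewrite -dyw rpredX.
have dzw : (z - e%:~R) * w = evQ (('X - e%:~R%:P) * (2%:P * B)) z.
  by rewrite !evE ratr_int /w !evE.
have Ezw : ((z - e%:~R) * w) ^+ 2 = (z - e%:~R) * evZ s z.
  by rewrite -ds exprMn exprMn step_sqr; ring.
have [r dr] : exists r : {poly int}, (z - e%:~R) * w = evZ r z.
  rewrite dzw; apply: icz; rewrite -dzw; apply: (Aint_of_exp _ 2) => //.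
  by rewrite Ezw rpredM // Aint_evZ.
have [t dt] : exists t, evZ r z = (z - e%:~R) * evZ t z.
  by apply: (step_reduced r s); rewrite -dr.
have dw : w = evZ t z by apply: (mulfI step_neq0); rewrite dr.
exists ((U \Po quad) + ('X + b%:P) * (t \Po quad)).
by rewrite evZD evZM !evZ_comp -/z -dU -dw dP /w !evE ratr_nat -/y; field.
Qed.

End Step.
End Quadratic.

(** * Iterates of a quadratic polynomial *)

Lemma iter_polySr n (q : {poly int}) :
  iter_poly n.+1 q = iter_poly n q \Po q.
Proof.
elim: n => [|n IH]; first by rewrite /iter_poly /= comp_polyXr comp_polyX.
by rewrite -[LHS]/(q \Po iter_poly n.+1 q) {1}IH comp_polyA.
Qed.

Lemma horner_iter_poly n (q : {poly int}) c :
  (iter_poly n q).[c] = iter n (horner q) c.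
Proof.
by elim: n => [|n IH]; rewrite /iter_poly /= ?hornerX // horner_comp IH.
Qed.

Section Iterates.
Variables (b e : int).
Let q := quad b e.
Let F n := iter_poly n q.

Lemma size_quad : size q = 3%N.
Proof.
have s2 : size (('X + b%:P) ^+ 2) = 3%N.
  by rewrite -[b]opprK polyCN size_exp_XsubC.
by rewrite /q /quad size_polyDl s2 // ltnS (leq_trans (size_polyC_leq1 _)).
Qed.

Lemma monic_quad : q \is monic.
Proof.
have s2 : size (('X + b%:P) ^+ 2) = 3%N.
  by rewrite -[b]opprK polyCN size_exp_XsubC.
rewrite monicE /q /quad lead_coefDl ?lead_coef_exp ?lead_coefXaddC ?expr1n //.
by rewrite s2 ltnS (leq_trans (size_polyC_leq1 _)).
Qed.

Lemma size_iter_quad n : size (F n) = (2 ^ n).+1.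
Proof.
elim: n => [|n IH]; first by rewrite /F /iter_poly size_polyX.
have := size_comp_poly (F n) q.
rewrite -iter_polySr -/(F n.+1) IH size_quad /= => h.
rewrite -[LHS]prednK ?h ?expnSr // lt0n; apply/eqP=> h0.
by move: h; rewrite h0; have := expn_gt0 2 n; lia.
Qed.

Lemma monic_iter_quad n : F n \is monic.
Proof.
elim: n => [|n IH]; first by rewrite /F /iter_poly monicX.
rewrite /F iter_polySr monicE lead_coef_comp ?size_quad //.
by rewrite (monicP IH) (monicP monic_quad) expr1n mulr1.
Qed.

(** Squaring is additive modulo 2. *)
Lemma iter_quad_mod2 n (s : int) : exists H,
  F n = ('X - s%:P) ^+ (2 ^ n) + ((F n).[s])%:P + H *+ 2.
Proof.
elim: n => [|n [H IH]].
  by exists 0; rewrite /F /iter_poly /= hornerX expr1; ring.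
set v := (F n).[s] in IH.
have FS : F n.+1 = (F n + b%:P) ^+ 2 + e%:P.
  rewrite /F /iter_poly iterS /q /quad rmorphD rmorphXn rmorphD /=.
  by rewrite comp_polyX !comp_polyC.
have vS : (F n.+1).[s] = (v + b) ^+ 2 + e by rewrite FS !hornerE.
set P := ('X - s%:P) ^+ (2 ^ n) in IH.
have -> : ('X - s%:P) ^+ (2 ^ n.+1) = P ^+ 2 by rewrite expnSr exprM.
exists (P * (v%:P + b%:P) + (P + v%:P + b%:P) * H *+ 2 + H ^+ 2 *+ 2).
rewrite vS FS IH rmorphD rmorphXn rmorphD /=; ring.
Qed.

(** The value at s of the 2 H of [iter_quad_mod2] is 0, so all of F_n(s) / 2,
    an odd integer, is left as the constant term around s. *)
Lemma iter_quad_eisenstein n (s : int) :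
  (iter n (horner q) s = 2 %[mod 4])%Z ->
  exists2 H, F n = ('X - s%:P) ^+ (2 ^ n) + H *+ 2 & ~~ (2 %| H.[s])%Z.
Proof.
rewrite -horner_iter_poly -/(F n) => m4; have [H dF] := iter_quad_mod2 n s.
have Hs : H.[s] = 0.
  have /(congr1 (horner^~ s)) := dF.
  rewrite 2!hornerD hornerMn hornerC horner_exp !hornerE subrr expr0n.
  by rewrite expn_eq0 /=; move: (F n).[s] H.[s] => v w; lia.
have [k dk] : exists k, (F n).[s] = k *+ 2.
  by exists ((F n).[s] %/ 2)%Z; lia.
exists (H + k%:P); last by rewrite hornerD hornerC Hs; lia.
by rewrite {1}dF dk; ring.
Qed.

Theorem quad_monogenic :
  (forall n, (1 <= n)%N ->
     exists s : int, (iter n (horner q) s = 2 %[mod 4])%Z) ->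
  (forall n, (1 <= n)%N -> squarefree (iter n (horner q) (- b))) ->
  forall n, (1 <= n)%N -> monogenic (F n).
Proof.
move=> H2 Hsq.
have irr n : irreducible_poly (toQ (F n)).
  case: n => [|n].
    rewrite /F /iter_poly /= map_polyX -['X]subr0 -polyC0.
    exact: irredp_XsubC.
  have [s /iter_quad_eisenstein[H dF Hs]] := H2 n.+1 isT.
  apply: (eis_irreducible _ H s (2 ^ n.+1)) => //.
  - exact: monic_iter_quad.
  - by rewrite expn_gt0.
  - exact: size_iter_quad.
suff ic n : forall x, evZ (F n) x = 0 -> int_closed x.
  by move=> n _; apply/(monogenicP _ (monic_iter_quad n) (irr n)); apply: ic.
elim: n => [x|n IH x Fx].
  (* F 0 is X, whose root 0 generates Z. *)
  rewrite /F /iter_poly /= map_polyX hornerX => -> u.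
  rewrite -(rmorph0 (ratr : rat -> algC)) horner_map /= => A.
  have /intrP[k ->] := Cint_rat_Aint (Crat_rat _) A.
  by exists k%:P; rewrite evZC.
have [s /iter_quad_eisenstein[H dF Hs]] := H2 n.+1 isT.
move=> P AP.
have Fz : evZ (F n) (evZ q x) = 0 by rewrite -evZ_comp -iter_polySr.
have [U dU] : exists U : {poly int}, evQ P x = evZ U x / 2.
  apply: (step_half b e (F n)) => //.
  - exact: monic_iter_quad.
  - by have := irr n.+1; rewrite [F n.+1]iter_polySr.
  - exact: IH.
  - have := Hsq n.+1 isT; rewrite iterSr -horner_iter_poly.
    by have -> : q.[- b] = e by rewrite horner_quad; ring.
rewrite dU; apply: (eis_half (F n.+1) H s (2 ^ n.+1)) => //.
- exact: monic_iter_quad.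
- by rewrite expn_gt0.
- by rewrite -dU.
Qed.

(** * Necessary conditions from the first two iterates *)

Lemma iter_quad_root n : exists x : algC, evZ (F n) x = 0.
Proof.
have /closed_rootP[x /eqP Fx] : size (map_poly intr (F n) : {poly algC}) != 1%N.
  rewrite size_map_inj_poly ?size_iter_quad ?rmorph0 //; last exact: intr_inj.
  by rewrite eqSS -lt0n expn_gt0.
by exists x.
Qed.

(** A square root of an algebraic integer is one, so P(x) / p would be
    integral. *)
Lemma monogenic_sqr_not_divisible n (P S : {poly int}) (p : nat) :
  monogenic (F n) -> prime p -> P \is monic -> (size P <= 2 ^ n)%N ->
  ~ (forall x, evZ (F n) x = 0 -> evZ P x ^+ 2 = p%:R ^+ 2 * evZ S x).
Proof.
move=> M pp mP sP HS; have [x Fx] := iter_quad_root n.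
have : evZ P x / p%:R \notin Aint.
  apply: (monogenic_not_divisible (F n)) => //; last exact: prime_gt1.
  by rewrite size_iter_quad.
apply/negP; rewrite negbK; apply: (Aint_of_exp _ 2) => //.
have p0 : (p%:R : algC) != 0 by rewrite pnatr_eq0 -lt0n prime_gt0.
rewrite expr_div_n HS // mulrAC mulfV ?mul1r ?expf_neq0 //.
by apply/Aint_evZ/(Aint_root_monic (F n)) => //; apply: monic_iter_quad.
Qed.

Lemma evZ_iter1 x : evZ (F 1) x = (x + b%:~R) ^+ 2 + e%:~R.
Proof. by rewrite /F /iter_poly /= comp_polyXr evZ_quad. Qed.

Lemma evZ_iter2 x :
  evZ (F 2) x = ((x + b%:~R) ^+ 2 + e%:~R + b%:~R) ^+ 2 + e%:~R.
Proof. by rewrite [F 2]iter_polySr evZ_comp evZ_iter1 evZ_quad. Qed.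

Lemma monogenic1_squarefree : monogenic (F 1) -> squarefree e.
Proof.
move=> M p pp; apply/negP=> /dvdzP[k dk].
apply: (monogenic_sqr_not_divisible 1 ('X + b%:P) (- k%:P) p) => //.
- exact: monicXaddC.
- by rewrite size_XaddC.
move=> x; rewrite evZ_iter1 => /eqP; rewrite addr_eq0 => /eqP.
by rewrite dk expnS expn1 !evE => ->; rewrite intrM; ring.
Qed.

Lemma monogenic1_mod4 : monogenic (F 1) -> (e <> 3 %[mod 4])%Z.
Proof.
move=> M e4; have [k dk] : exists k, e = 4 * k - 1.
  by exists ((e + 1) %/ 4)%Z; lia.
have [x Fx] := iter_quad_root 1.
have : evZ ('X + (b + 1)%:P) x / 2%:R \notin Aint.
  apply: (monogenic_not_divisible (F 1)) => //; first exact: monicXaddC.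
  by rewrite size_iter_quad size_XaddC.
apply/negP; rewrite negbK.
(* For y^2 = -e = 1 - 4k, the number (y + 1) / 2 is a root of X^2 - X + k. *)
apply: (Aint_root_monic ('X ^+ 2 - 'X + k%:P)).
  rewrite -addrA monicE lead_coefDl ?lead_coefXn //.
  rewrite size_polyXn (leq_ltn_trans (size_polyD _ _)) // size_polyN size_polyX.
  by rewrite gtn_max /= (leq_ltn_trans (size_polyC_leq1 _)).
have := Fx; rewrite evZ_iter1 dk !evE rmorphB rmorphM /= => E.
have -> : ((x + (b + 1)%:~R) / 2) ^+ 2 - (x + (b + 1)%:~R) / 2 + k%:~R =
   ((x + b%:~R) ^+ 2 + (4%:~R * k%:~R - 1)) / 4 by field.
by rewrite E mul0r.
Qed.

Lemma monogenic2_squarefree :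
  monogenic (F 2) -> squarefree (e + (e + b) ^+ 2).
Proof.
move=> M p pp; apply/negP=> /dvdzP[k dk].
pose Y := 'X + b%:P.
pose c : {poly int} := ((e + b) *+ 2)%:P.
have sY : size Y = 2%N by rewrite size_XaddC.
have mY : Y \is monic by apply: monicXaddC.
have dP : Y * (Y ^+ 2 + c) = ('X * ('X ^+ 2 + c)) \Po Y.
  by rewrite comp_polyM comp_polyD comp_Xn_poly comp_polyC comp_polyX.
have s3 : size ('X ^+ 2 + c) = 3%N.
  by rewrite size_polyDl size_polyXn // ltnS (leq_trans (size_polyC_leq1 _)).
have m3 : 'X ^+ 2 + c \is monic.
  rewrite monicE lead_coefDl ?lead_coefXn // size_polyXn ltnS.
  by rewrite (leq_trans (size_polyC_leq1 _)).
apply: (monogenic_sqr_not_divisible 2 (Y * (Y ^+ 2 + c)) (- k%:P * (Y ^+ 2 + c)) p) => //.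
- rewrite dP monicE lead_coef_comp ?sY // (monicP mY) expr1n mulr1.
  by rewrite lead_coefM lead_coefX mul1r (monicP m3).
- by rewrite dP size_comp_poly2 // mulrC size_mulX ?s3 // monic_neq0.
move=> x; rewrite evZ_iter2 => E.
have {}dk : e%:~R + (e%:~R + b%:~R) ^+ 2 = k%:~R * p%:R ^+ 2 :> algC.
  have -> : k%:~R * p%:R ^+ 2 = (k * (p ^ 2)%N%:Z)%:~R :> algC.
    by rewrite expnS expn1 PoszM !intrM; ring.
  by rewrite -dk; ring.
rewrite /Y /c !evE; set y := x + b%:~R in E *.
rewrite -[((e + b) *+ 2)]mulr_natr !(rmorphM, rmorphD, rmorphXn) /=.
set v := y ^+ 2 + _.
have -> : (y * v) ^+ 2 = - (k%:~R * p%:R ^+ 2) * v.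
  rewrite -dk; apply/eqP; rewrite -subr_eq0; apply/eqP.
  rewrite -[RHS](mulr0 v) -E /v; ring.
ring.
Qed.

End Iterates.

(** * Critical orbits and discriminants *)

Lemma quad_pcf (b e : int) (s : seq int) :
  - b \in s -> {in s, forall c, (quad b e).[c] \in s} -> pcf (quad b e).
Proof.
move=> bs cs; exists (map intr s) => c n.
have -> : (map_poly intr (quad b e) : {poly algC})^`() = ('X + b%:~R%:P) *+ 2.
  rewrite /quad rmorphD rmorphXn rmorphD /= map_polyX !map_polyC /=.
  rewrite derivD derivC addr0 expr2 derivM derivD derivX derivC addr0.
  by rewrite mul1r mulr1 mulr2n.
rewrite /root hornerMn mulrn_eq0 /= !hornerE addr_eq0 => /eqP ->.
rewrite -rmorphN /=.
suff [k ks ->] : exists2 k, k \in s &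
    iter n (horner (map_poly intr (quad b e))) (- b)%:~R = k%:~R :> algC.
  by apply: map_f.
elim: n => [|n [k ks IH]]; first by exists (- b).
by exists (quad b e).[k]; [exact: cs | rewrite iterS IH evZ_int].
Qed.

Lemma discriminant_quad (b e : int) : discriminant (quad b e) / 4 = (- e)%:~R.
Proof.
rewrite /discriminant /croots; case: closed_field_poly_normal => rs /= drs.
have lc : lead_coef (quad b e) = 1 by apply/monicP/monic_quad.
have sz : size (map_poly intr (quad b e) : {poly algC}) = 3%N.
  by rewrite size_map_inj_poly ?size_quad //; exact: intr_inj.
have lcC : lead_coef (map_poly intr (quad b e) : {poly algC}) = 1.
  by apply/monicP/monic_map/monic_quad.
rewrite lcC scale1r in drs.
have : size rs = 2%N by move: sz; rewrite drs size_prod_XsubC => -[].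
case: rs drs => [|r0 [|r1 [|//]]] //= drs _.
rewrite lc expr1n mul1r !big_ord_recl !big_ord0 /= mulr1.
rewrite [X in X * _ / _]big_mkcond [X in _ * X / _]big_mkcond /=.
rewrite !big_ord_recl !big_ord0 /= !mul1r !mulr1.
rewrite !big_cons big_nil mulr1 in drs.
have ev x : evZ (quad b e) x = (x - r0) * (x - r1) by rewrite drs !hornerE.
(* The sum and the product of the roots are read off the values at 0 and 1. *)
have := ev 0; have := ev 1; rewrite !evZ_quad => E1 E0.
have s1 : r0 + r1 = - (b%:~R *+ 2).
  have H : (1 - r0) * (1 - r1) - (0 - r0) * (0 - r1) = 1 + b%:~R *+ 2.
    by rewrite -E1 -E0; ring.
  apply/eqP; rewrite -subr_eq0 -oppr_eq0; apply/eqP.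
  by rewrite -[RHS](subrr (1 + b%:~R *+ 2)) -{1}H; ring.
have -> : (r0 - r1) ^+ 2 = (r0 + r1) ^+ 2 - 4 * ((0 - r0) * (0 - r1)) by ring.
by rewrite -E0 s1; field.
Qed.

(** * The three families *)

Lemma f_quad a : f_ a = quad a (- a).
Proof. by rewrite /f_ /quad polyCN. Qed.
Lemma g_quad a : g_ a = quad a (- a - 1).
Proof. by rewrite /g_ /quad polyCB polyCN; ring. Qed.
Lemma h_quad a : h_ a = quad a (- a - 2).
Proof. by rewrite /h_ /quad polyCB polyCN; ring. Qed.

Lemma iter_fixed (T : Type) (f : T -> T) c n : f c = c -> iter n f c = c.
Proof. by move=> fc; elim: n => //= n ->. Qed.

Lemma f_monogenicP a :
  (forall n : nat, (1 <= n)%N -> monogenic (iter_poly n (f_ a))) <->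
  (squarefree a /\ ((a = 2 %[mod 4])%Z \/ (a = 3 %[mod 4])%Z)).
Proof.
rewrite f_quad; split=> [M|[sq m]].
  have /squarefreeN sq := monogenic1_squarefree _ _ (M 1%N isT).
  have m3 := monogenic1_mod4 _ _ (M 1%N isT); have m0 := squarefree_mod4 _ sq.
  by split=> //; lia.
apply: quad_monogenic => -[//|n] _; last first.
  rewrite iter_fixed ?horner_quad; last by ring.
  exact/squarefreeN.
case: m => m; [exists (- a) | exists (1 - a)].
  rewrite iter_fixed ?horner_quad; last by ring.
  lia.
rewrite iter_fixed ?horner_quad; last by ring.
lia.
Qed.

(** The critical orbit is the 2-cycle {-a, -a-1}.  Under the congruence
    condition one of its points is 2 modulo 4, and every iterate of g takes that
    value on the cycle, at a point that depends on the parity of the iterate. *)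
Lemma g_monogenicP a :
  (forall n : nat, (1 <= n)%N -> monogenic (iter_poly n (g_ a))) <->
  (squarefree a /\ squarefree (a + 1) /\
   ((a + 1 = 2 %[mod 4])%Z \/ (a + 1 = 3 %[mod 4])%Z)).
Proof.
rewrite g_quad; split=> [M|[sq0 [sq1 m]]].
  have sq1 := monogenic1_squarefree _ _ (M 1%N isT).
  have sq2 := monogenic2_squarefree _ _ (M 2%N isT).
  have m3 := monogenic1_mod4 _ _ (M 1%N isT); have m0 := squarefree_mod4 _ sq1.
  split; last split; last by lia.
    by apply/squarefreeN; move: sq2; congr squarefree; ring.
  by apply/squarefreeN; move: sq1; congr squarefree; ring.
pose g := horner (quad a (- a - 1)).
have g0 : g (- a) = - a - 1 by rewrite /g horner_quad; ring.
have g1 : g (- a - 1) = - a by rewrite /g horner_quad; ring.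
apply: quad_monogenic => n _; rewrite -/g.
  have [[s0 H0] [s1 H1]] :
      (exists s, iter n g s = - a) /\ (exists s, iter n g s = - a - 1).
    elim: n => [|n [[s0 H0] [s1 H1]]].
      by split; [exists (- a) | exists (- a - 1)].
    by split; [exists s1 | exists s0]; rewrite iterS ?H0 ?H1.
  by case: m => m; [exists s1; rewrite H1 | exists s0; rewrite H0]; lia.
have [->|->] : iter n g (- a) = - a \/ iter n g (- a) = - a - 1.
- by elim: n => [|n [IH|IH]]; [left | right | left]; rewrite ?iterS ?IH.
- exact/squarefreeN.
- by apply/squarefreeN; move: sq1; congr squarefree; ring.
Qed.

Lemma h_monogenicP a :
  (forall n : nat, (1 <= n)%N -> monogenic (iter_poly n (h_ a))) <->
  (squarefree (a - 2) /\ squarefree (a + 2) /\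
   ((a + 2 = 2 %[mod 4])%Z \/ (a + 2 = 3 %[mod 4])%Z)).
Proof.
rewrite h_quad; split=> [M|[sqm [sqp m]]].
  have sq1 := monogenic1_squarefree _ _ (M 1%N isT).
  have sq2 := monogenic2_squarefree _ _ (M 2%N isT).
  have m3 := monogenic1_mod4 _ _ (M 1%N isT); have m0 := squarefree_mod4 _ sq1.
  split; last split; last by lia.
    by apply/squarefreeN; move: sq2; congr squarefree; ring.
  by apply/squarefreeN; move: sq1; congr squarefree; ring.
pose h := horner (quad a (- a - 2)).
have hc : h (- a) = - a - 2 by rewrite /h horner_quad; ring.
have hv : h (- a - 2) = 2 - a by rewrite /h horner_quad; ring.
have h2 : h (2 - a) = 2 - a by rewrite /h horner_quad; ring.
have h1 : h (- 1 - a) = - 1 - a by rewrite /h horner_quad; ring.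
(* The two fixed points of h are 2 - a and -1 - a. *)
apply: quad_monogenic => -[//|n] _; rewrite -/h; last first.
  rewrite iterSr hc; case: n => [|n] /=.
    by apply/squarefreeN; move: sqp; congr squarefree; ring.
  rewrite -iterS iterSr hv iter_fixed //.
  by apply/squarefreeN; move: sqm; congr squarefree; ring.
by case: m => m; [exists (2 - a) | exists (- 1 - a)]; rewrite iter_fixed //; lia.
Qed.

Theorem proposition5p3 (a : int) :
  [/\ pcf (f_ a), pcf (g_ a) & pcf (h_ a)] /\
  [/\ discriminant (f_ a) / 4 = a%:~R,
      discriminant (g_ a) / 4 = (a + 1)%:~R &
      discriminant (h_ a) / 4 = (a + 2)%:~R] /\
  [/\ (forall n : nat, (1 <= n)%N -> monogenic (iter_poly n (f_ a))) <->
      (squarefree a /\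
       ((a = 2 %[mod 4])%Z \/ (a = 3 %[mod 4])%Z)),
      (forall n : nat, (1 <= n)%N -> monogenic (iter_poly n (g_ a))) <->
      (squarefree a /\ squarefree (a + 1) /\
       ((a + 1 = 2 %[mod 4])%Z \/ (a + 1 = 3 %[mod 4])%Z)) &
      (forall n : nat, (1 <= n)%N -> monogenic (iter_poly n (h_ a))) <->
      (squarefree (a - 2) /\ squarefree (a + 2) /\
       ((a + 2 = 2 %[mod 4])%Z \/ (a + 2 = 3 %[mod 4])%Z))].
Proof.
split; [|split].
- rewrite f_quad g_quad h_quad; split.
  + apply: (quad_pcf _ _ [:: - a]); rewrite ?inE // => c.
    by rewrite !inE horner_quad => /eqP->; apply/eqP; ring.
  + apply: (quad_pcf _ _ [:: - a; - a - 1]); rewrite ?inE ?eqxx // => c.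
    rewrite !inE horner_quad => /orP[]/eqP->; apply/orP; [right|left];
      apply/eqP; ring.
  + apply: (quad_pcf _ _ [:: - a; - a - 2; 2 - a]); rewrite ?inE ?eqxx // => c.
    rewrite !inE horner_quad => /or3P[]/eqP->; apply/or3P;
      [apply: Or32|apply: Or33|apply: Or33]; apply/eqP; ring.
- rewrite f_quad g_quad h_quad.
  by split; rewrite discriminant_quad; congr (_%:~R); ring.
- by split; [exact: f_monogenicP | exact: g_monogenicP | exact: h_monogenicP].
Qed.
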